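(* Let $m\leq n$ be positive integers. If $f\in\mathcal{H}_{n}$ and $g\in\mathcal{H}_{m}$, and $f\bullet g=\{F_0,\ldots,F_{n-m}\}$ is their generalized Hadamard product, then (a) $F_{0},F_{n-m}\in\mathcal{H}_{m}$; (b) $f\bullet g\subset\overline{\mathcal{H}_{m}}$.
   Context: For an integer $k\ge 0$, $\mathbb{R}_k^+$ denotes the set of real polynomials $s\mapsto c_0+c_1s+\ldots+c_ks^k$ with all $c_i>0$ ($i=0,\ldots,k$). For $k\ge 1$, $\mathcal{H}_k$ is the set of $f\in\mathbb{R}_k^+$ all of whose complex zeros have negative real part (Hurwitz stable polynomials), and $\overline{\mathcal{H}_k}$ is the set of $f\in\mathbb{R}_k^+$ all of whose complex zeros have non-positive real part (quasi-stable polynomials with positive coefficients). For $f(s)=\sum_{i=0}^n a_is^i\in\mathbb{R}_n^+$ and $g(s)=\sum_{i=0}^m b_is^i\in\mathbb{R}_m^+$ with $m\le n$, the generalized Hadamard product of $f$ and $g$ is the set $f\bullet g=\{F_0,\ldots,F_{n-m}\}$, where $F_j(s)=\sum_{i=0}^m a_{j+i}b_is^i$ for $j=0,\ldots,n-m$. *)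

(* Defs.v *)
From mathcomp Require Import all_boot all_order all_algebra.
From mathcomp Require Import complex.
From mathcomp Require Import classical_sets reals.

Set Implicit Arguments.
Unset Strict Implicit.
Unset Printing Implicit Defensive.

Import Order.TTheory GRing.Theory Num.Theory.
Local Open Scope ring_scope.
Local Open Scope classical_set_scope.

(* The condition [size p = k.+1] says that [p] has degree exactly [k]. *)
Definition pos_poly (R : realType) (k : nat) : set {poly R} :=
  [set p | size p = k.+1 /\ forall i : nat, (i <= k)%N -> 0 < p`_i].

Definition complex_zero (R : realType) (p : {poly R}) (z : R[i]) : Prop :=
  root (map_poly (real_complex R) p) z.

Definition hurwitz (R : realType) (k : nat) : set {poly R} :=
  [set p | pos_poly k p /\
           forall z : R[i], complex_zero p z -> complex.Re z < 0].

Definition quasi_stable (R : realType) (k : nat) : set {poly R} :=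
  [set p | pos_poly k p /\
           forall z : R[i], complex_zero p z -> complex.Re z <= 0].

Definition hadamard_comp (R : realType) (m : nat) (f g : {poly R}) (j : nat) :
    {poly R} :=
  \poly_(i < m.+1) (f`_(j + i) * g`_i).

(* The degrees [n] of [f] and [m] of [g] are explicit parameters; the set is the
   intended one when [m <= n], the subtraction on [nat] being truncated. *)
Definition gen_hadamard (R : realType) (n m : nat) (f g : {poly R}) :
    set {poly R} :=
  [set hadamard_comp m f g j | j in [set j : nat | (j <= n - m)%N]].

(* Main.v *)
Require Import Defs.
From mathcomp Require Import all_boot all_order all_algebra.
From mathcomp Require Import complex.
From mathcomp Require Import classical_sets reals.
From mathcomp Require Import ring zify.

Import Order.TTheory GRing.Theory Num.Theory.
Local Open Scope ring_scope.
Local Open Scope classical_set_scope.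

(* Put h = X^j g and F(S) = sum_i f_i h_i S^i, which is S^j F_j(S); every F_j
   turns out to be strictly stable.  For fixed S <> 0 with Re S >= 0, F(S) is a
   coefficient of the polynomial
     Q(t) = sum over i + k even of f_i h_k S^((i+k)/2) t^(d + (k-i)/2),  d = size f.
   Writing S = t p^2 and q = t p, so that pq = S and q/p = t, gives
     2 Q(t) = t^d (f(p) h(q) + f(-p) h(-q)).
   When Re S >= 0 and Re t >= 0, p and q lie in a common closed half-plane and
   are not both imaginary, so by stability and reality |f(-p) h(-q)| and
   |f(p) h(q)| differ.  Hence all nonzero roots of Q lie in the open left
   half-plane, and by Gauss-Lucas Q has no zero coefficient between two nonzero
   ones; it remains to exhibit a nonzero coefficient on each side of F(S). *)

(** * Parity arithmetic for exponents *)

Lemma diag_exponent n i j : (i < n)%N -> ~~ odd (i + j) ->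
  ((n - i + (n + j))./2 + (i + j)./2 = n + j)%N.
Proof. lia. Qed.

Lemma diag_exponent_high n i j d : (i < n)%N -> ~~ odd (i + j) ->
  (n + d == (n - i + (n + j))./2)%N = (j == i + d.*2)%N.
Proof. lia. Qed.

Lemma diag_exponent_low n i j d : (d <= n)%N -> (i < n)%N -> ~~ odd (i + j) ->
  (n - d == (n - i + (n + j))./2)%N = (i == j + d.*2)%N.
Proof. lia. Qed.

Section HalfPlane.
Variable C : numClosedFieldType.
Implicit Types (p q t z S : C) (h f g Q : {poly C}).

(** * Stability, Gauss-Lucas and the absence of gaps among coefficients *)

Definition stable h := forall z, 0 <= 'Re z -> h.[z] != 0.

Lemma stable_roots h : h != 0 -> stable h ->
  {r : seq C | h = lead_coef h *: \prod_(a <- r) ('X - a%:P) &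
    {in r, forall a, 'Re a < 0}}.
Proof.
move=> h0 st; have [r hE] := closed_field_poly_normal h.
exists r => // a ar; rewrite real_ltNge ?Creal_Re ?real0 //.
apply/negP => /st/negP; apply.
by rewrite -rootE hE rootZ ?lead_coef_eq0 // root_prod_XsubC.
Qed.

Lemma Re_inv_gt0 z : 0 < 'Re z -> 0 < 'Re z^-1.
Proof.
move=> z0; have zn0 : z != 0 by apply: contraTneq z0 => ->; rewrite raddf0 ltxx.
by rewrite ReV divr_gt0 // exprn_gt0 ?normr_gt0.
Qed.

(** The logarithmic derivative is the sum of the [(z - a)^-1]; each [z - a] lies in the open right
    half-plane, which inversion preserves. *)
Lemma log_deriv_prod (r : seq C) z (P := \prod_(a <- r) ('X - a%:P)) :
  {in r, forall a, 'Re a < 0} -> 0 <= 'Re z -> r != [::] ->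
  0 < 'Re (P^`().[z] / P.[z]).
Proof.
move=> + z0; rewrite {}/P; case: r => // a r rlt _.
have zfar b : b \in a :: r -> 0 < 'Re (z - b).
  by move=> /rlt b0; rewrite raddfB subr_gt0 (lt_le_trans b0).
have sumE s : all [in a :: r] s ->
    (\prod_(b <- s) ('X - b%:P))^`().[z] / (\prod_(b <- s) ('X - b%:P)).[z]
    = \sum_(b <- s) (z - b)^-1.
  elim: s => [|b s IHs] /=; first by rewrite !big_nil derivC horner0 mul0r.
  case/andP=> br sr; rewrite !big_cons -IHs // derivM derivXsubC mul1r.
  have zb : z - b != 0.
    by apply: contraTneq (zfar _ br) => ->; rewrite raddf0 ltxx.
  have P0 : (\prod_(b <- s) ('X - b%:P)).[z] != 0.
    rewrite -/(root _ z) root_prod_XsubC; apply/negP => /(allP sr)/zfar.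
    by rewrite subrr raddf0 ltxx.
  by rewrite hornerD !hornerM hornerXsubC; field; rewrite P0.
rewrite sumE; last exact/allP.
rewrite big_cons raddfD ltr_wpDr ?Re_inv_gt0 ?zfar ?mem_head //.
rewrite raddf_sum big_seq sumr_ge0 // => b br.
by rewrite ltW ?Re_inv_gt0 ?zfar ?inE ?br ?orbT.
Qed.

(** A zero of the derivative at [z] would make the logarithmic derivative vanish there, although its
    real part is positive. *)
Lemma stable_deriv h : stable h -> h^`() != 0 -> stable h^`().
Proof.
move=> st h'0 z z0; have h0 : h != 0 by apply: contraNneq h'0 => ->; rewrite derivC.
have [r hE rlt] := stable_roots _ h0 st.
have r0 : r != [::].
  by apply: contraNneq h'0 => r0; rewrite hE r0 big_nil derivZ derivC scaler0.
have := log_deriv_prod _ _ rlt z0 r0; rewrite hE derivZ hornerZ.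
apply: contraTneq => /eqP; rewrite mulf_eq0 lead_coef_eq0 (negPf h0) /= => /eqP->.
by rewrite mul0r raddf0 ltxx.
Qed.

(** Differentiating [k] times turns the coefficient of index [k] into the value at 0, up to a
    nonzero integer factor; the coefficient of index [i] keeps these derivatives nonzero, hence
    stable. *)
Lemma stable_coef h i k : stable h -> (k <= i)%N -> h`_i != 0 -> h`_k != 0.
Proof.
elim: k i h => [|k IHk] i h st; first by move=> _ _; rewrite -horner_coef0 st ?raddf0.
case: i => // i ki hi.
have h'i : h^`()`_i != 0 by rewrite coef_deriv mulrn_eq0.
have := IHk _ _ (stable_deriv _ st _) ki h'i; rewrite coef_deriv mulrn_eq0; apply.
by apply: contraNneq h'i => ->; rewrite coef0.
Qed.

Lemma stable_off0_coef Q i j k :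
  (forall z, z != 0 -> 0 <= 'Re z -> Q.[z] != 0) ->
  (i <= j <= k)%N -> Q`_i != 0 -> Q`_k != 0 -> Q`_j != 0.
Proof.
move=> st /andP[ij jk] Qi Qk.
have exQ : exists n, Q`_n != 0 by exists i.
(* [l] is the order of vanishing at 0; dividing by ['X^l] removes the only zero allowed in the
   closed right half-plane. *)
case: (ex_minnP exQ) => l Ql lmin; have lj := leq_trans (lmin _ Qi) ij.
have QE : drop_poly l Q * 'X^l = Q.
  rewrite -[RHS](poly_take_drop l) [take_poly l Q](_ : _ = 0) ?add0r //.
  apply/polyP => u; rewrite coef_take_poly coef0; case: ltnP => // ul.
  by apply/eqP; apply: contraTT ul => /lmin; rewrite -leqNgt.
have stD : stable (drop_poly l Q).
  move=> z z0; have [->|zn0] := eqVneq z 0.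
    by rewrite horner_coef0 coef_drop_poly.
  by have := st _ zn0 z0; rewrite -{1}QE hornerM mulf_eq0 negb_or => /andP[].
have := stable_coef _ (k - l) (j - l) stD; rewrite !coef_drop_poly !subnK //.
  by apply=> //; rewrite leq_sub2r.
exact: leq_trans jk.
Qed.

(** * Comparison of moduli at opposite points *)

Definition mirror_dominating h := forall z, z != 0 -> 0 <= 'Re z ->
  h.[z] != 0 /\ `|h.[- z]| <= `|h.[z]| ?= iff ('Re z == 0).

(** Reflection in the imaginary axis moves [z] to the side of [a]; the squared distances differ by
    [- 4 * 'Re z * 'Re a]. *)
Lemma norm_mirror a z : 'Re a < 0 -> 0 <= 'Re z ->
  `|- z^* - a| <= `|z - a| ?= iff ('Re z == 0).
Proof.
move=> a0 z0.
have sqrE : `|z - a| ^+ 2 = `|- z^* - a| ^+ 2 + 4 * ('Re z * - 'Re a).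
  by rewrite !normCK !ReE !rmorphB rmorphN /= conjCK; field.
apply/leifP; have [z00|zn0] := eqVneq ('Re z) 0.
  by rewrite -(@eqrXn2 _ 2) ?normr_ge0 // sqrE z00 mul0r mulr0 addr0.
rewrite -ltr_sqr ?nnegrE ?normr_ge0 // sqrE ltrDl mulr_gt0 ?ltr0n //.
by rewrite mulr_gt0 ?oppr_gt0 // lt0r zn0.
Qed.

Lemma norm_mirror_prod (r : seq C) z : {in r, forall a, 'Re a < 0} -> 0 <= 'Re z ->
  `|(\prod_(a <- r) ('X - a%:P)).[- z^*]| <= `|(\prod_(a <- r) ('X - a%:P)).[z]|
    ?= iff (r == [::]) || ('Re z == 0).
Proof.
elim: r => [|a r IHr] rlt z0; first by rewrite big_nil !hornerC; apply/leif_refl.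
have a0 := rlt a (mem_head _ _).
have {}rlt : {in r, forall b, 'Re b < 0}.
  by move=> b br; rewrite rlt // inE br orbT.
have {}IHr := IHr rlt z0.
have za : z - a != 0.
  by apply: contraTneq z0 => /subr0_eq->; rewrite -real_ltNge ?Creal_Re ?real0.
have P0 : (\prod_(b <- r) ('X - b%:P)).[z] != 0.
  rewrite -/(root _ z) root_prod_XsubC; apply/negP => zr.
  by have := rlt z zr; rewrite real_ltNge ?Creal_Re ?real0 // z0.
have := leif_pM (normr_ge0 _) (normr_ge0 _) (norm_mirror _ _ a0 z0) IHr.
(* [leif_pM] also counts a vanishing upper bound as equality; [za] and [P0] exclude that. *)
rewrite mulf_eq0 !normr_eq0 (negPf za) (negPf P0) /= andb_orr andbb.
by rewrite orb_idl => [|/andP[] //]; rewrite !big_cons !hornerM !hornerXsubC !normrM.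
Qed.

Lemma real_mirror_dominating h : (1 < size h)%N -> map_poly Num.conj h = h ->
  stable h -> mirror_dominating h.
Proof.
move=> h1 hreal st z _ z0; split; first exact: st.
have h0 : h != 0 by apply: contraTneq h1 => ->; rewrite size_poly0.
have [r hE rlt] := stable_roots _ h0 st.
(* A root must exist: for a constant, equality would hold everywhere. *)
have r0 : r != [::].
  apply: contraTneq h1 => r0; rewrite hE r0 big_nil -leqNgt alg_polyC.
  exact: size_polyC_leq1.
(* Real coefficients give conjugate values at conjugate points, so [- z] may be traded for the
   reflected point. *)
have -> : `|h.[- z]| = `|h.[- z^*]|.
  by rewrite -rmorphN -{2}hreal horner_map norm_conjC.
have := norm_mirror_prod _ _ rlt z0.
rewrite hE !hornerZ !normrM (negPf r0) => /leifP le.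
apply/leifP; case: ('Re z == 0) le; first by move/eqP->; rewrite eqxx.
by rewrite ltr_pM2l // normr_gt0 lead_coef_eq0.
Qed.

Lemma mirror_dominating_mulX f j :
  mirror_dominating f -> mirror_dominating (f * 'X^j).
Proof.
move=> mf z z0 rz; have [fz le] := mf z z0 rz.
rewrite !hornerM !hornerXn mulf_neq0 ?expf_neq0 //; split=> //.
rewrite !normrM !normrX normrN; apply/leifP; move/leifP: le.
by case: ('Re z == 0); [move/eqP->; rewrite eqxx |
  rewrite ltr_pM2r // exprn_gt0 // normr_gt0].
Qed.

Lemma mirror_sum_neq0 f g p t :
  mirror_dominating f -> mirror_dominating g -> p != 0 -> t != 0 ->
  0 <= 'Re t -> 0 <= 'Re (t * p ^+ 2) ->
  f.[p] * g.[t * p] + f.[- p] * g.[- (t * p)] != 0.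
Proof.
move=> mf mg p0 t0 rt rS; set q := t * p.
have q0 : q != 0 by rewrite mulf_neq0.
have both_ge0 (a b : C) : a \is Num.real -> 0 <= b * a -> 0 < a + b -> 0 <= a.
  move=> ar ab0 sab; rewrite real_leNgt ?real0 //; apply/negP => a0.
  move: ab0; rewrite nmulr_lge0 // => b0.
  by have := lt_le_trans sab (lerD (ltW a0) b0); rewrite addr0 ltxx.
(* Both points lie in the closed right half-plane, at least one off the imaginary axis; the moduli
   of the two products then differ strictly, so they cannot cancel. *)
have pos a b : a != 0 -> b != 0 -> 0 <= 'Re b * 'Re a -> 0 < 'Re a + 'Re b ->
    f.[a] * g.[b] + f.[- a] * g.[- b] != 0.
  move=> a0 b0 rba rab.
  have ra := both_ge0 _ _ (Creal_Re a) rba rab.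
  have rb : 0 <= 'Re b.
    by apply: (both_ge0 _ ('Re a)); rewrite ?Creal_Re 1?mulrC 1?addrC.
  have [fa lef] := mf a a0 ra; have [gb leg] := mg b b0 rb.
  have := leif_pM (normr_ge0 _) (normr_ge0 _) lef leg.
  rewrite mulf_eq0 !normr_eq0 (negPf fa) (negPf gb) /= -paddr_eq0 // gt_eqF //.
  rewrite -!normrM => /leifP; apply: contraTneq => /eqP.
  by rewrite addr_eq0 => /eqP->; rewrite normrN ltxx.
(* [S1] and [S2] are [0 <= Re (p q)] and [0 <= Re (q p^* )]. *)
have S1 : 0 <= 'Re q * 'Re p - 'Im q * 'Im p by rewrite -ReM -mulrA -expr2.
have S2 : 0 <= 'Re q * 'Re p + 'Im q * 'Im p.
  have : 0 <= 'Re (q * p^* ).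
    by rewrite -mulrA -normCK ReMr ?rpredX ?normr_real // mulr_ge0 // exprn_ge0.
  by rewrite ReM Re_conj Im_conj mulrN opprK.
(* Adding [S1] and [S2] cancels the imaginary parts. *)
have pq0 : 0 <= 'Re q * 'Re p.
  have := addr_ge0 S1 S2.
  rewrite [X in 0 <= X](_ : _ = ('Re q * 'Re p) *+ 2); last by ring.
  by rewrite pmulrn_lge0.
(* A zero sum and [pq0] would put both points on the imaginary axis, where [S1] and [S2] force one
   of them to be 0. *)
have sum0 : 'Re p + 'Re q != 0.
  apply/eqP => /eqP; rewrite addr_eq0 => /eqP pq.
  have q00 : 'Re q = 0.
    move: pq0; rewrite pq mulrN oppr_ge0 => q2; apply/eqP.
    rewrite -sqrf_eq0 eq_le real_exprn_even_ge0 ?Creal_Re // andbT.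
    by rewrite expr2.
  move: S1 S2; rewrite pq q00 oppr0 mulr0 sub0r add0r oppr_ge0 => S1 S2.
  have : 'Im q * 'Im p == 0 by rewrite eq_le S1 S2.
  rewrite mulf_eq0 => /orP[] /eqP im0.
    by case/eqP: q0; rewrite [q]Crect q00 im0 mulr0 addr0.
  by case/eqP: p0; rewrite [p]Crect pq q00 im0 oppr0 mulr0 addr0.
(* The expression is invariant under changing the signs of both [p] and [q], which reduces a
   negative sum to a positive one. *)
have [rpq|rpq|] := real_ltgtP (rpredD (Creal_Re p) (Creal_Re q)) (real0 _).
- have := pos (- p) (- q); rewrite !opprK [_ + f.[p] * _]addrC; apply.
  + by rewrite oppr_eq0.
  + by rewrite oppr_eq0.
  + by rewrite !raddfN /= mulrNN.
  + by rewrite !raddfN /= -opprD oppr_gt0.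
- exact: pos.
- by move/eqP; rewrite (negPf sum0).
Qed.

(** * The auxiliary polynomial and its coefficients *)

(* The coefficient of index [size f + d] collects the pairs [j = i + 2d], and
   that of index [size f - d] the pairs [i = j + 2d]. *)
Definition diagonals f g S : {poly C} :=
  \sum_(i < size f) \sum_(j < size g)
    (if odd (i + j) then 0 else f`_i * g`_j * S ^+ (i + j)./2)
      *: 'X^((size f - i + (size f + j))./2).

(** In the expanded right side the terms with [i + j] odd cancel and the others double. *)
Lemma horner_diagonals f g p t :
  2 * (diagonals f g (t * p ^+ 2)).[t] =
  t ^+ size f * (f.[p] * g.[t * p] + f.[- p] * g.[- (t * p)]).
Proof.
rewrite horner_sum !horner_coef !big_distrlr -big_split /= !mulr_sumr.
apply: eq_bigr => i _; rewrite horner_sum -big_split /= !mulr_sumr.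
apply: eq_bigr => j _; rewrite hornerZ hornerXn.
have -> : f`_i * (- p) ^+ i * (g`_j * (- (t * p)) ^+ j) =
    (-1) ^+ odd (i + j) * (f`_i * p ^+ i * (g`_j * (t * p) ^+ j)).
  by rewrite signr_odd (exprNn p) (exprNn (t * p)) exprD; ring.
case: ifP => [_|/negbT odd_ij]; first by rewrite expr1; ring.
set e := ((_ - _ + _)./2)%N.
transitivity (2 * (f`_i * g`_j) * p ^+ (i + j) * t ^+ (e + (i + j)./2)).
  by rewrite exprMn -exprM mul2n even_halfK // [t ^+ (_ + _)]exprD; ring.
by rewrite /e (diag_exponent _ _ _ (ltn_ord i) odd_ij) !exprD exprMn; ring.
Qed.

Lemma coef_diagonals_high f g S d :
  (diagonals f g S)`_(size f + d) =
  \sum_(i < size f) f`_i * g`_(i + d.*2) * S ^+ (i + d).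
Proof.
rewrite coef_sum; apply: eq_bigr => i _; rewrite coef_sum.
transitivity (\sum_(j < size g | j == (i + d.*2)%N :> nat)
    f`_i * g`_j * S ^+ (i + j)./2).
  rewrite [RHS]big_mkcond; apply: eq_bigr => j _; rewrite coefZ coefXn.
  case: ifP => [odd_ij|/negbT odd_ij].
    by rewrite mul0r; case: eqP => // jE; move: odd_ij; rewrite jE; lia.
  by rewrite diag_exponent_high //; case: eqP; rewrite ?mulr1 ?mulr0.
rewrite (big_ord1_eq _ (fun j => f`_i * g`_j * S ^+ (i + j)./2)).
have -> : (i + (i + d.*2))./2 = (i + d)%N by lia.
by case: ltnP => // gi; rewrite (nth_default _ gi) mulr0 mul0r.
Qed.

Lemma coef_diagonals_low f g S d : (d <= size f)%N ->
  (diagonals f g S)`_(size f - d) =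
  \sum_(j < size g) f`_(j + d.*2) * g`_j * S ^+ (j + d).
Proof.
move=> dle; rewrite /diagonals exchange_big coef_sum.
apply: eq_bigr => j _; rewrite coef_sum.
transitivity (\sum_(i < size f | i == (j + d.*2)%N :> nat)
    f`_i * g`_j * S ^+ (i + j)./2).
  rewrite [RHS]big_mkcond; apply: eq_bigr => i _; rewrite coefZ coefXn.
  case: ifP => [odd_ij|/negbT odd_ij].
    by rewrite mul0r; case: eqP => // iE; move: odd_ij; rewrite iE; lia.
  by rewrite diag_exponent_low //; case: eqP; rewrite ?mulr1 ?mulr0.
rewrite (big_ord1_eq _ (fun i => f`_i * g`_j * S ^+ (i + j)./2)).
have -> : (j + d.*2 + j)./2 = (j + d)%N by lia.
by case: ltnP => // fi; rewrite (nth_default _ fi) !mul0r.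
Qed.

Lemma diagonals_neq0 f g S t :
  mirror_dominating f -> mirror_dominating g -> S != 0 -> 0 <= 'Re S ->
  t != 0 -> 0 <= 'Re t -> (diagonals f g S).[t] != 0.
Proof.
move=> mf mg S0 rS t0 rt; pose p := sqrtC (S / t).
have SE : S = t * p ^+ 2 by rewrite sqrtCK mulrC divfK.
have p0 : p != 0 by rewrite sqrtC_eq0 mulf_neq0 ?invr_eq0.
rewrite SE in rS *; have := mirror_sum_neq0 _ _ _ _ mf mg p0 t0 rt rS.
apply: contraNneq => Qt; have := horner_diagonals f g p t; rewrite Qt mulr0.
by move/esym/eqP; rewrite mulf_eq0 expf_eq0 (negPf t0) andbF.
Qed.

(** * Nonvanishing of the Hadamard sums *)

(** The three sums are the coefficients of [diagonals f g S] at [size f - d], [size f + e] and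
    [size f]; the last index lies between the other two. *)
Lemma hadamard_neq0 f g S d e :
  mirror_dominating f -> mirror_dominating g -> S != 0 -> 0 <= 'Re S ->
  (d <= size f)%N -> \sum_(j < size g) f`_(j + d.*2) * g`_j * S ^+ (j + d) != 0 ->
  \sum_(i < size f) f`_i * g`_(i + e.*2) * S ^+ (i + e) != 0 ->
  \sum_(i < size f) f`_i * g`_i * S ^+ i != 0.
Proof.
move=> mf mg S0 rS dle; rewrite -coef_diagonals_low // -coef_diagonals_high.
move=> low high; have := @stable_off0_coef _ _ (size f + 0) _ _ _ low high.
rewrite coef_diagonals_high; under eq_bigr do rewrite !addn0; apply.
  by move=> t t0 rt; apply: diagonals_neq0.
by rewrite addn0 leq_subr leq_addr.
Qed.

(** The sum is [S ^+ k * (a + b * S)], whose second factor has real part at least [a]. Allowing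
    [b = 0] covers diagonals with a single term. *)
Lemma big_two_neq0 (u : nat -> C) N l S a b k : (l.+1 < N)%N ->
  (forall i, i != l -> i != l.+1 -> u i = 0) ->
  u l = a * S ^+ k -> u l.+1 = b * S ^+ k.+1 ->
  0 < a -> 0 <= b -> S != 0 -> 0 <= 'Re S -> \sum_(i < N) u i != 0.
Proof.
move=> lN u0 ul uSl a0 b0 S0 rS.
rewrite (bigD1 (Ordinal (ltnW lN))) //= (bigD1 (Ordinal lN)) /=; last first.
  by rewrite -val_eqE /= gtn_eqF.
rewrite big1 => [|i /andP[il iSl]]; last by rewrite u0.
rewrite addr0 ul uSl exprSr mulrA -[b * _ * _]mulrAC -mulrDl mulf_neq0 ?expf_neq0 //.
have : 0 < 'Re (a + b * S).
  rewrite raddfD /= ReMl ?ger0_real // (Creal_ReP _ _) ?gtr0_real //.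
  by rewrite ltr_wpDr // mulr_ge0.
by apply: contraTneq => ->; rewrite raddf0 ltxx.
Qed.

Lemma shifted_hadamard_neq0 f g n m J S :
  mirror_dominating f -> mirror_dominating g ->
  size f = n.+1 -> size g = m.+1 -> (0 < m)%N -> (J + m <= n)%N ->
  (forall i, (i <= n)%N -> 0 < f`_i) -> (forall i, (i <= m)%N -> 0 < g`_i) ->
  S != 0 -> 0 <= 'Re S -> (\poly_(i < m.+1) (f`_(J + i) * g`_i)).[S] != 0.
Proof.
move=> mf mg fn gm m0 Jmn fpos gpos S0 rS; pose gJ := g * 'X^J.
have gJE i : gJ`_i = if (J <= i <= J + m)%N then g`_(i - J) else 0.
  rewrite coefMXn ltnNge; case: leqP => //= Ji; case: leqP => // iJm.
  by rewrite nth_default // gm; lia.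
have gJ_pos i : (J <= i <= J + m)%N -> 0 < gJ`_i.
  by move=> Ji; rewrite gJE Ji gpos //; lia.
have gJ_ge0 i : 0 <= gJ`_i.
  by rewrite gJE; case: ifP => // Ji; rewrite ltW // gpos; lia.
have gJ_size : size gJ = (J + m).+1.
  by rewrite size_mulXn ?gm ?addnS // -size_poly_eq0 gm.
have f_ge0 i : 0 <= f`_i.
  by case: (leqP i n) => [/fpos/ltW //|ni]; rewrite nth_default ?fn.
(* The shifts [d] and [e] are the largest with [J + 2d <= n] and [2e <= J + m]. As [0 < m], also
   [J <= 2e], so the first term of each of these diagonals has a positive coefficient. *)
have := hadamard_neq0 f gJ S (n - J)./2 (J + m)./2 mf
  (mirror_dominating_mulX _ J mg) S0 rS.
rewrite -(horner_poly _ (fun i => f`_i * gJ`_i)).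
have -> : \poly_(i < size f) (f`_i * gJ`_i) =
    \poly_(i < m.+1) (f`_(J + i) * g`_i) * 'X^J.
  apply/polyP => i; rewrite coefMXn !coef_poly fn gJE; case: (ltnP i J) => [iJ|Ji].
    by rewrite mulr0 if_same.
  have -> : (J + (i - J) = i)%N by lia.
  case: (leqP i (J + m)) => iJm; last by rewrite mulr0 if_same ifF //; lia.
  by rewrite !ifT //; lia.
rewrite hornerM hornerXn mulf_eq0 negb_or => neq0.
(* The outermost diagonals have at most the two terms [j = J, J + 1] and
   [i = 0, 1] respectively. *)
have low : \sum_(j < size gJ)
    f`_(j + (n - J)./2.*2) * gJ`_j * S ^+ (j + (n - J)./2) != 0.
  apply: (@big_two_neq0
    (fun j => f`_(j + (n - J)./2.*2) * gJ`_j * S ^+ (j + (n - J)./2))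
    _ J _ _ _ _ _ _ erefl erefl) => //;
    rewrite ?gJ_size; first lia.
  - move=> i iJ iSJ; rewrite gJE; case: ifP => Ji; last by rewrite mulr0 mul0r.
    by rewrite (nth_default _ (_ : (size f <= _)%N)) ?mul0r // fn; lia.
  - by rewrite mulr_gt0 ?gJ_pos ?fpos //; lia.
  - by rewrite mulr_ge0.
have high : \sum_(i < size f)
    f`_i * gJ`_(i + (J + m)./2.*2) * S ^+ (i + (J + m)./2) != 0.
  apply: (@big_two_neq0
    (fun i => f`_i * gJ`_(i + (J + m)./2.*2) * S ^+ (i + (J + m)./2))
    _ 0 _ _ _ _ _ _ erefl erefl) => //;
    rewrite ?fn; first lia.
  - move=> i i0 i1; rewrite (nth_default _ (_ : (size gJ <= _)%N)) ?mulr0 ?mul0r //.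
    by rewrite gJ_size; lia.
  - by rewrite mulr_gt0 ?gJ_pos ?fpos //; lia.
  - by rewrite mulr_ge0.
have dle : ((n - J)./2 <= size f)%N by rewrite fn; lia.
by have /andP[] := neq0 dle low high.
Qed.

End HalfPlane.

(** * Transfer to real polynomials *)

Lemma hurwitz_mirror_dominating (R : realType) k (f : {poly R}) : (0 < k)%N ->
  hurwitz k f -> mirror_dominating _ (map_poly (real_complex R) f).
Proof.
move=> k0 [[fk fpos] froots]; apply: real_mirror_dominating.
- by rewrite size_map_poly fk.
- apply/polyP => i; rewrite !coef_map /=.
  by apply/CrealP; rewrite -complexr0 complex_real.
(* ['Re z] is the embedding of the real number [complex.Re z], so the two descriptions of the
   half-plane agree. *)
- move=> z; rewrite -complexRe lecR => z0; apply/negP => /froots.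
  by rewrite ltNge z0.
Qed.

Lemma hadamard_comp_hurwitz (R : realType) (m n j : nat) (f g : {poly R}) :
  (0 < m)%N -> (j + m <= n)%N -> hurwitz n f -> hurwitz m g ->
  hurwitz m (hadamard_comp m f g j).
Proof.
move=> m0 jmn fH gH; have [[fn fpos] _] := fH; have [[gm gpos] _] := gH.
have Fpos i : (i <= m)%N -> 0 < (hadamard_comp m f g j)`_i.
  by move=> im; rewrite coef_poly ltnS im mulr_gt0 ?fpos ?gpos //; lia.
split=> [|z]; first split=> //.
  by rewrite size_poly_eq //= mulf_neq0 // gt_eqF ?fpos ?gpos.
rewrite /complex_zero => Fz; rewrite ltNge; apply/negP => rz.
(* The nonvanishing lemma excludes 0; there the value is the constant coefficient, which is
   positive. *)
have [z0|z0] := eqVneq z 0.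
  have := Fpos 0 isT; move: Fz; rewrite z0 -(rmorph0 (real_complex R)).
  by rewrite fmorph_root rootE horner_coef0 => /eqP->; rewrite ltxx.
move: Fz; apply/negP; rewrite rootE.
have -> : map_poly (real_complex R) (hadamard_comp m f g j) =
    \poly_(i < m.+1) ((map_poly (real_complex R) f)`_(j + i) *
                      (map_poly (real_complex R) g)`_i).
  apply/polyP => i; rewrite [RHS]coef_poly !coef_map coef_poly.
  by case: ifP => _; [apply: (rmorphM (real_complex R)) | apply: raddf0].
apply: (@shifted_hadamard_neq0 _ _ _ n) => //.
- by apply: (hurwitz_mirror_dominating _ n) => //; lia.
- exact: (hurwitz_mirror_dominating _ m).
- by rewrite size_map_poly.
- by rewrite size_map_poly.
- by move=> i /fpos; rewrite coef_map ltcR.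
- by move=> i /gpos; rewrite coef_map ltcR.
- by rewrite -complexRe lecR.
Qed.

Theorem theorem3 (R : realType) (m n : nat) (m_gt0 : (0 < m)%N)
    (n_gt0 : (0 < n)%N) (le_mn : (m <= n)%N) (f g : {poly R})
    (f_hurwitz : hurwitz n f) (g_hurwitz : hurwitz m g) :
  (hurwitz m (hadamard_comp m f g 0) /\
   hurwitz m (hadamard_comp m f g (n - m))) /\
  gen_hadamard n m f g `<=` quasi_stable (R := R) m.
Proof.
have FH j : (j <= n - m)%N -> hurwitz m (hadamard_comp m f g j).
  by move=> jnm; apply: (@hadamard_comp_hurwitz _ _ n) => //; lia.
split; first by split; apply: FH.
by move=> _ [j /FH [Fpos Froots] <-]; split=> // z /Froots/ltW.
Qed.
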